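(* Let $d\in\mathbb{N}$ be fixed. Assume that $\zeta\in L^2([0,1]\times[0,1])$, that $\lambda_d>0$, and that: (L) for all $x\in\mathbb{R}$, $\lim_{n\to\infty}P\big(a(\log n)\,T_n(Y;v,\lambda)-b_d(\log n)\le x\big)=\exp(-2\exp(-x))$. Assume moreover that there is a positive rate function $g(n)$ such that the following hold as $n\to\infty$: (P1) $\max_{1\le k<n}k^{-1/2}\big\|\sum_{i=1}^kY_i\big\|=O_P(g(n))$ and $\max_{1\le k<n}k^{-1/2}\big\|\sum_{i=1}^kY_{-i}\big\|=O_P(g(n))$; (A1) under $H_0$, $\max_{i=1,\dots,d}|\hat\lambda_i-\lambda_i|=o_P\big((\log\log n)^{-1}\big)$; (A2) under $H_0$, $\max_{i=1,\dots,d}\|\hat v_i-s_iv_i\|=o_P\big((\log\log n)^{-1/2}/g(n)\big)$, where the $s_i$ are random with $s_i\in\{1,-1\}$. Then under $H_0$, for all $x\in\mathbb{R}$, $$\lim_{n\to\infty}P\big(a(\log n)\,\hat T_n-b_d(\log n)\le x\big)=\exp(-2\exp(-x)).$$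
   Context: All function spaces are real; $\langle\cdot,\cdot\rangle$ and $\|\cdot\|$ are the inner product and norm of $L^2[0,1]$; $\int=\int_0^1$. Model. $\{Y_i\}_{i\in\mathbb{Z}}$ are $L^2[0,1]$-valued random elements on a probability space $(\Omega,\mathcal{A},P)$, product measurable in $(t,\omega)$. Standing assumption: $\{Y_i\}$ is centered and strictly stationary with $E\|Y_1\|^\nu<\infty$ for some $\nu>2$. The observations are $X_i(t)=\mu_i(t)+Y_i(t)$, $t\in[0,1]$, with deterministic $\mu_i\in L^2[0,1]$. The null hypothesis is $H_0:\ \mu_1=\dots=\mu_n$. Long run covariance. $\zeta(t,s)=\sum_{r\in\mathbb{Z}}E[Y_0(t)Y_r(s)]$ (convergence in $L^2([0,1]\times[0,1])$), and $(\mathcal{C}x)(t)=\int\zeta(t,s)x(s)\,ds$. When $\zeta\in L^2([0,1]\times[0,1])$, $\mathcal{C}$ is a symmetric positive Hilbert–Schmidt operator with eigenvalues $\lambda_1\ge\lambda_2\ge\dots\ge0$ and corresponding orthonormal eigenfunctions $v_1,v_2,\dots$. Statistics. For a sequence of functions $Z=\{Z_i\}$ (with $\bar Z_n=n^{-1}\sum_{i=1}^nZ_i$), orthonormal functions $u=\{u_i\}$ and non-negative scalars $\ell=\{\ell_i\}$, put $$\eta_{k,r}(Z;u)=n^{-1/2}\int\sum_{i=1}^k[Z_i(t)-\bar Z_n(t)]u_r(t)\,dt,$$ $$T_n(Z;u,\ell)=\max_{1\le k<n}w(k/n)\Big(\frac{\eta_{k,1}^2(Z;u)}{\ell_1}+\dots+\frac{\eta_{k,d}^2(Z;u)}{\ell_d}\Big)^{1/2},\qquad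 w(t)=(t(1-t))^{-1/2},$$ with the convention $T_n=\infty$ if $\ell_r=0$ for some $1\le r\le d$. The estimated statistic is $\hat T_n=T_n(X;\hat v,\hat\lambda)$, where $\{\hat v_i\}$ are random orthonormal functions and $\hat\lambda_1\ge\hat\lambda_2\ge\dots\ge0$ are random scalars (both depending on $n$), serving as generic estimates of $\{v_i\}$ and $\{\lambda_i\}$. Normalizing functions. $a(t)=(2\log t)^{1/2}$ and $b_d(t)=2\log t+(d/2)\log\log t-\log\Gamma(d/2)$. *)

(* Defs.v *)
From HB Require Import structures.
From mathcomp Require Import all_boot all_order all_algebra.
From mathcomp Require Import all_classical all_reals all_analysis.

Set Implicit Arguments.
Unset Strict Implicit.
Unset Printing Implicit Defensive.

Import Order.TTheory GRing.Theory Num.Theory.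
Import numFieldNormedType.Exports.

Local Open Scope classical_set_scope.
Local Open Scope ring_scope.

(* Sequences numbered 1, 2, ... in the mathematics are handled as follows:
   observations keep their numbers (Y_1 is [Y 1]), while eigenvalues and
   eigenfunctions are counted from 0 (lambda_d is [lam d.-1]). *)

Section L2_space.
Context {R : realType}.

(* Lebesgue measure on [0,1], seen as a measure on the line: functions on
   [0,1] are functions on R whose values outside [0,1] are irrelevant. *)
Definition leb01 : set (measurableTypeR R) -> \bar R :=
  mrestr (@lebesgue_measure R) (measurable_itv `[0%R, 1%R]).

HB.instance Definition _ := Measure.on leb01.

Let leb01_fin : fin_num_fun leb01.
Proof.
move=> A mA; rewrite ge0_fin_numE; last exact: measure_ge0.
rewrite /leb01 /mrestr.
apply: (@le_lt_trans _ _ (@lebesgue_measure R `[0%R, 1%R]%classic)).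
  by apply: le_measure; rewrite ?inE //; apply: measurableI.
by rewrite lebesgue_measure_itv/= lte_fin ltr01 -EFinB ltry.
Qed.

HB.instance Definition _ := Measure_isFinite.Build _ _ _ leb01 leb01_fin.

End L2_space.
Arguments leb01 : clear implicits.

(* L^2[0,1] as the real vector space of square integrable functions; equality
   of elements of L^2 is equality almost everywhere. *)
Notation L2 R := (@LfunType _ (measurableTypeR R) R (leb01 R) _ (lee1n 2)).

Section L2_structure.
Context {R : realType}.
Implicit Types f g : L2 R.

Definition dot f g : R := \int[leb01 R]_t (f t * g t).

Definition L2norm f : R := fine ('N[leb01 R]_2%:E[EFin \o f]).

Definition L2eq f g : Prop := f = g %[ae leb01 R].

Definition L2orthonormal (u : nat -> L2 R) : Prop :=
  forall i j, dot (u i) (u j) = (i == j)%:R.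

Definition L2open (U : set (L2 R)) : Prop :=
  forall f, U f -> exists2 e : R, 0 < e & forall g, L2norm (g - f) < e -> U g.

Definition L2open_tuple m (U : set ('I_m -> L2 R)) : Prop :=
  forall f : 'I_m -> L2 R, U f -> exists2 e : R, 0 < e &
    forall g : 'I_m -> L2 R, (forall i, L2norm (g i - f i) < e) -> U g.

Definition L2borel : set (set (L2 R)) := <<s L2open >>.

Definition L2borel_tuple m : set (set ('I_m -> L2 R)) := <<s @L2open_tuple m >>.

End L2_structure.

Section processes.
Context {R : realType} {d : measure_display} {Omega : measurableType d}.
Variable P : probability Omega R.

Definition random_element (Z : Omega -> L2 R) : Prop :=
  (forall B, L2borel B -> measurable (Z @^-1` B)) /\
  @measurable_fun _ _ (Omega * measurableTypeR R)%type (measurableTypeR R)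
    ([set: Omega] `*` `[0, 1]%classic) (fun p => Z p.1 p.2).

(* The mean of an integrable product measurable L^2-valued element is the
   function t |-> E[Z(t)]. *)
Definition centered (Y : int -> Omega -> L2 R) : Prop :=
  forall i, {ae leb01 R, forall t, ('E_P[fun w => Y i w t] = 0)%E}.

Definition strictly_stationary (Y : int -> Omega -> L2 R) : Prop :=
  forall m (idx : 'I_m -> int) (h : int) B, L2borel_tuple B ->
    P [set w | B (fun j => Y (idx j + h) w)] =
    P [set w | B (fun j => Y (idx j) w)].

Definition autocov (Y : int -> Omega -> L2 R) (r : int) (p : R * R) : R :=
  \int[P]_w (Y 0 w p.1 * Y r w p.2).

(* zeta = sum over all r in Z of autocov Y r, in L^2([0,1] x [0,1]); the sum
   over Z is the limit of the sums over -N <= r <= N. *)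
Definition long_run_cov (Y : int -> Omega -> L2 R) (zeta : R * R -> R) : Prop :=
  let mu2 := (leb01 R \x leb01 R)%E in
  let partial_sum N p := \sum_(0 <= r < N.+1) autocov Y r%:Z p
                       + \sum_(1 <= r < N.+1) autocov Y (- r%:Z) p in
  zeta \in Lfun mu2 2%:E /\
  ('N[mu2]_2%:E[EFin \o (fun p => partial_sum N p - zeta p)%R])%E
    @[N --> \oo] --> 0%E.

Definition OP (Z : nat -> Omega -> R) (g : nat -> R) : Prop :=
  forall e : R, 0 < e -> exists2 M : R, 0 < M &
    \forall n \near \oo, (P [set w | (M * g n < `|Z n w|)%R] <= e%:E)%E.

Definition oP (Z : nat -> Omega -> R) (g : nat -> R) : Prop :=
  forall e : R, 0 < e ->
    P [set w | e * g n < `|Z n w|] @[n --> \oo] --> 0%E.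

End processes.

Section long_run_covariance_operator.
Context {R : realType}.
Implicit Types (zeta : R * R -> R) (x : L2 R).

Definition covop zeta x (t : R) : R := \int[leb01 R]_s (zeta (t, s) * x s).

Definition eigen zeta (kappa : R) x : Prop :=
  {ae leb01 R, forall t, covop zeta x t = kappa * x t}.

(* The last clause says that every nonzero eigenvalue occurs among the lam i
   as many times as its multiplicity. *)
Definition eigen_system zeta (lam : nat -> R) (v : nat -> L2 R) : Prop :=
  [/\ forall i, 0 <= lam i.+1 <= lam i,
      L2orthonormal v,
      forall i, eigen zeta (lam i) (v i) &
      forall kappa x, kappa != 0 -> eigen zeta kappa x ->
        (forall i, dot x (v i) = 0) -> L2eq x 0].

End long_run_covariance_operator.

Definition observations {R : realType} {d : measure_display}
    {Omega : measurableType d} (mu : nat -> L2 R) (Y : int -> Omega -> L2 R)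
    (i : nat) (w : Omega) : L2 R :=
  mu i + Y i%:Z w.

Section statistics.
Context {R : realType}.
Implicit Types (Z u : nat -> L2 R) (l : nat -> R).

Definition H0 (mu : nat -> L2 R) (n : nat) : Prop :=
  forall i j, (1 <= i <= n)%N -> (1 <= j <= n)%N -> L2eq (mu i) (mu j).

Definition Zbar Z (n : nat) : L2 R := n%:R^-1 *: \sum_(1 <= i < n.+1) Z i.

Definition eta_stat Z u (n k r : nat) : R :=
  (Num.sqrt n%:R)^-1 * dot (\sum_(1 <= i < k.+1) (Z i - Zbar Z n)) (u r).

Definition weight (t : R) : R := (Num.sqrt (t * (1 - t)))^-1.

Definition Tstat (d n : nat) Z u l : \bar R :=
  if [exists r : 'I_d, l r == 0] then +oo%E else
  (\big[Num.max/0]_(1 <= k < n)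
     (weight (k%:R / n%:R) *
      Num.sqrt (\sum_(r < d) eta_stat Z u n k r ^+ 2 / l r)))%:E.

Definition partial_norm_max Z (n : nat) : R :=
  \big[Num.max/0]_(1 <= k < n)
    ((Num.sqrt k%:R)^-1 * L2norm (\sum_(1 <= i < k.+1) Z i)).

Definition Gamma (s : R) : R :=
  \int[@lebesgue_measure R]_(t in `]0%R, +oo[) (t `^ (s - 1) * expR (- t)).

Definition anorm (t : R) : R := Num.sqrt (2 * ln t).

Definition bnorm (d : nat) (t : R) : R :=
  2 * ln t + d%:R / 2 * ln (ln t) - ln (Gamma (d%:R / 2)).

(* a(log n) T_n - b_d(log n), possibly +oo *)
Definition normalized (d n : nat) (T : \bar R) : \bar R :=
  ((anorm (ln n%:R))%:E * T - (bnorm d (ln n%:R))%:E)%E.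

End statistics.

(* Main.v *)
Require Import Defs.
From HB Require Import structures.
From mathcomp Require Import all_boot all_order all_algebra.
From mathcomp Require Import all_classical all_reals all_analysis.
From mathcomp Require Import measurable_realfun zify ring lra.

Set Implicit Arguments.
Unset Strict Implicit.
Unset Printing Implicit Defensive.

Import Order.TTheory GRing.Theory Num.Theory.
Import numFieldNormedType.Exports.

Local Open Scope classical_set_scope.
Local Open Scope ring_scope.

(** The estimated statistic differs from the one computed with the true
    eigenvalues and eigenfunctions by an amount that vanishes in probability
    even after multiplication by a(log n), so both have the same limit law.

    Under the null hypothesis the means cancel in the centred partial sums, and
    the statistic is the maximum over k of a weighted Euclidean norm of the
    scores of w(k/n) n^(-1/2) (S_k - (k/n) S_n), where S_k is the k-th partial
    sum of the errors Y_i ([eta_statE], [eta_stat_shift]). Two estimation errors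
    have to be controlled.

    Eigenfunctions. Writing S_k - (k/n) S_n as a convex combination of S_k and
    -(S_n - S_k), the weight w(k/n) turns the norm of the first term into
    |S_k| / sqrt k and that of the second into |S_n - S_k| / sqrt (n - k)
    ([bridge_le]). The maximum over k of the first is O_P(g) by assumption. The
    second is a partial sum of the errors read backwards from time n, which by
    stationarity is distributed as a partial sum of the Y_(-i)
    ([stationary_partial_norm_max]), and is O_P(g) for that reason. By
    Cauchy-Schwarz the replacement of v_r by its estimate costs at most
    O_P(g) o_P((log log n)^(-1/2) / g) = o_P((log log n)^(-1/2)). The random
    signs are harmless because only squares of scores enter the statistic.

    Eigenvalues. Replacing lambda_r by its estimate changes the statistic by a
    relative error of the order of the estimation error,
    o_P(1 / log log n) ([wnorm_perturb_weight]). The limit theorem assumed for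
    the statistic with the true parameters shows that this statistic is
    O_P((log log n)^(1/2)), and the absolute error is again
    o_P((log log n)^(-1/2)).

    Since a(log n) = (2 log log n)^(1/2), both errors disappear
    ([maxstat_perturb], [scaled_close]), and a Slutsky argument concludes
    because the limit distribution function is continuous ([cvg_distr_close]).

    All these bounds are deterministic outside an exceptional event. For the
    probabilities to be meaningful this event has to be measurable. Every random
    quantity involved is a continuous function of inner products of product
    measurable functions, and these are measurable by Fubini's theorem
    ([measurable_dot]). *)

(** * Inner products *)

Section semi_inner_product.
Context {R : rcfType} {V : lmodType R} (B : V -> V -> R).
Context (BC : forall x y, B x y = B y x)
  (BD : forall x y z, B (x + y) z = B x z + B y z)
  (BZ : forall a x y, B (a *: x) y = a * B x y)
  (B_ge0 : forall x, 0 <= B x x).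

Lemma bilin_sqrD x y : B (x + y) (x + y) = B x x + 2 * B x y + B y y.
Proof. by rewrite BD ![B _ (x + y)]BC !BD (BC y x); ring. Qed.

(** Cauchy-Schwarz for a form that may be degenerate. It is used both for the
    inner product of square integrable functions, where norm zero only means
    zero almost everywhere, and for weighted Euclidean norms. *)
Lemma sqr_bilin_le x y : B x y ^+ 2 <= B x x * B y y.
Proof.
have key a b : 0 <= a ^+ 2 * B x x + 2 * a * b * B x y + b ^+ 2 * B y y.
  have := B_ge0 (a *: x + b *: y).
  rewrite bilin_sqrD !BZ ![B _ (_ *: _)]BC !BZ (BC y x).
  by lra.
have [Byy0|] := eqVneq (B y y) 0.
  (* These coefficients turn the quadratic form into -4 (B x y)^2. *)
  have := key (2 * B x y) (- (B x x + 1)); rewrite Byy0; lra.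
move=> By; have Byy : 0 < B y y by rewrite lt_def By B_ge0.
have := key (B y y) (- B x y).
rewrite (_ : _ + _ = B y y * (B x x * B y y - B x y ^+ 2)); last by ring.
by rewrite pmulr_rge0// subr_ge0.
Qed.

Lemma norm_bilin_le x y : `|B x y| <= Num.sqrt (B x x) * Num.sqrt (B y y).
Proof.
rewrite -sqrtrM// -sqrtr_sqr ler_wsqrtr//; exact: sqr_bilin_le.
Qed.

Lemma bilin_triangle x y :
  Num.sqrt (B (x + y) (x + y)) <= Num.sqrt (B x x) + Num.sqrt (B y y).
Proof.
rewrite -[leRHS]ger0_norm ?addr_ge0 ?sqrtr_ge0// -sqrtr_sqr.
rewrite ler_wsqrtr// bilin_sqrD sqrrD !sqr_sqrtr// lerD2r lerD2l.
have := le_trans (ler_norm _) (norm_bilin_le x y); lra.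
Qed.

End semi_inner_product.

Section L2.
Context {R : realType}.
Implicit Types f g h : L2 R.

Lemma integrable_L2M f g :
  (leb01 R).-integrable setT (EFin \o (fun t => f t * g t)).
Proof. by apply/Lfun1_integrable; apply: Lfun2_mul_Lfun1; exact: LfunP. Qed.

Lemma dotC f g : dot f g = dot g f.
Proof. by apply: eq_Rintegral => t _; rewrite mulrC. Qed.

Lemma dotDl f g h : dot (f + g) h = dot f h + dot g h.
Proof.
rewrite /dot -RintegralD//; try exact: integrable_L2M.
by apply: eq_Rintegral => t _ /=; rewrite -mulrDl.
Qed.

Lemma dotZl (a : R) f g : dot (a *: f) g = a * dot f g.
Proof.
rewrite /dot -RintegralZl//; last exact: integrable_L2M.
by apply: eq_Rintegral => t _ /=; rewrite mulrA.
Qed.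

Lemma dot_ge0 f : 0 <= dot f f.
Proof. by apply: Rintegral_ge0 => t _; rewrite -expr2 sqr_ge0. Qed.

Lemma L2normE f : L2norm f = Num.sqrt (dot f f).
Proof.
have h : (L2norm f)%:E = 'N[leb01 R]_2%:E[EFin \o f]%E := finite_norm_fine f.
have : (L2norm f ^+ 2)%:E = (dot f f)%:E.
  rewrite -powR_mulrn; last by rewrite fine_ge0// Lnorm_ge0.
  rewrite -poweR_EFin h powR_Lnorm// /dot /Rintegral fineK; last first.
    by apply: integrable_fin_num => //; exact: integrable_L2M.
  by apply: eq_integral => t _; rewrite /= powR_mulrn ?normr_ge0// real_normK ?num_real.
move=> [] <-; rewrite sqrtr_sqr ger0_norm// fine_ge0// Lnorm_ge0//.
Qed.

Lemma dot_suml (I : Type) (s : seq I) (P : pred I) (F : I -> L2 R) g :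
  dot (\sum_(i <- s | P i) F i) g = \sum_(i <- s | P i) dot (F i) g.
Proof.
elim/big_ind2 : _ => //; last by move=> f1 a f2 b <- <-; rewrite dotDl.
by have := dotZl 0 0 g; rewrite scale0r mul0r.
Qed.

Lemma dotNl f g : dot (- f) g = - dot f g.
Proof. by rewrite -scaleN1r dotZl mulN1r. Qed.

Lemma L2norm_ge0 f : 0 <= L2norm f.
Proof. by rewrite L2normE sqrtr_ge0. Qed.

Lemma L2normZ (a : R) f : L2norm (a *: f) = `|a| * L2norm f.
Proof.
by rewrite !L2normE dotZl dotC dotZl mulrA sqrtrM -?expr2 ?sqr_ge0// sqrtr_sqr.
Qed.

Lemma L2normD f g : L2norm (f + g) <= L2norm f + L2norm g.
Proof.
rewrite !L2normE.
exact: (bilin_triangle dotC dotDl dotZl dot_ge0).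
Qed.

Lemma norm_dot_le f g : `|dot f g| <= L2norm f * L2norm g.
Proof.
rewrite !L2normE.
exact: (norm_bilin_le dotC dotDl dotZl dot_ge0).
Qed.

Lemma dot_ae f g h : L2eq f g -> dot f h = dot g h.
Proof.
move=> fg; rewrite /dot /Rintegral; congr fine; apply: ae_eq_integral => //.
- by apply/measurable_EFinP; apply: measurable_funM.
- by apply/measurable_EFinP; apply: measurable_funM.
- by move: fg; apply: filterS => t /= fgt /fgt ->.
Qed.

Context {disp : measure_display} {Omega : measurableType disp}.

(** The part of [random_element] that is used: unlike Borel measurability in L2,
    whose stability under sums needs separability, it combines directly with
    Fubini's theorem. *)
Definition jointly_measurable (Z : Omega -> L2 R) : Prop :=
  @measurable_fun _ _ (Omega * measurableTypeR R)%type (measurableTypeR R)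
    ([set: Omega] `*` `[0, 1]%classic) (fun p => Z p.1 p.2).

(** Fubini's theorem, applied separately to the positive and the negative part
    of the product extended by zero outside [0,1]. *)
Lemma measurable_dot (Z W : Omega -> L2 R) :
  jointly_measurable Z -> jointly_measurable W ->
  measurable_fun setT (fun w => dot (Z w) (W w)).
Proof.
move=> mZ mW.
pose D : set (Omega * measurableTypeR R) := [set: Omega] `*` `[0, 1]%classic.
have mD : measurable D by apply: measurableX.
pose F := (fun p : Omega * measurableTypeR R => (Z p.1 p.2 * W p.1 p.2)%:E) \_ D.
have mF : measurable_fun setT F.
  apply/(measurable_restrictT _ mD)/measurable_EFinP; exact: measurable_funM.
have mint (G : _ -> \bar R) : measurable_fun setT G -> (forall x, (0 <= G x)%E) ->
    measurable_fun setT (fun w : Omega => (\int[leb01 R]_t G (w, t))%E).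
  by move=> mG G0; exact: (measurable_fun_fubini_tonelli_F G).
rewrite (_ : (fun w => _) = fine \o
   (fun w => \int[leb01 R]_t F^\+%E (w, t) - \int[leb01 R]_t F^\-%E (w, t)))%E.
  apply: measurableT_comp => //.
  apply: emeasurable_funB; apply: mint => //.
  - exact: measurable_funepos.
  - exact: measurable_funeneg.
apply/funext => w; rewrite /dot /Rintegral /=; congr fine.
transitivity (\int[leb01 R]_t F (w, t))%E.
  apply: ae_eq_integral => //.
  - by apply/measurable_EFinP; apply: measurable_funM.
  - exact: measurableT_comp.
  - exists (~` `[0, 1]%classic); split.
    + by apply: measurableC.
    + change ((@lebesgue_measure R (~` `[0, 1]%classic `&` `[0, 1]%classic)) = 0%E).
      by rewrite setICl measure0.
    + move=> t /=; apply: contra_not => t01 _.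
      rewrite /F patchE ifT// inE /D; split => //=.
rewrite integralE; congr (_ - _)%E; apply: eq_integral => t _.
  by rewrite !funeposE.
by rewrite !funenegE.
Qed.

End L2.

(** * Weighted Euclidean norms and maxima *)

Section weighted_l2.
Context {R : realType} {d : nat}.
Implicit Types (l x y : 'I_d -> R).

Definition wnorm l x : R := Num.sqrt (\sum_r x r ^+ 2 / l r).

Lemma wnorm_ge0 l x : 0 <= wnorm l x.
Proof. exact: sqrtr_ge0. Qed.

Lemma wnormM l x a : 0 <= a -> a * wnorm l x = wnorm l (fun r => a * x r).
Proof.
move=> a0; rewrite /wnorm -{1}[a]ger0_norm// -sqrtr_sqr -sqrtrM ?sqr_ge0//.
by congr Num.sqrt; rewrite mulr_sumr; apply: eq_bigr => r _; rewrite exprMn mulrA.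
Qed.

Lemma wnormD l x y : (forall r, 0 <= l r) ->
  wnorm l (fun r => x r + y r) <= wnorm l x + wnorm l y.
Proof.
move=> l0; pose B (x y : 'I_d -> R) := \sum_r x r * y r / l r.
have BE z : wnorm l z = Num.sqrt (B z z).
  by congr Num.sqrt; apply: eq_bigr => r _; rewrite expr2.
rewrite !BE; apply: (@bilin_triangle R ('I_d -> R) B).
- by move=> u v; apply: eq_bigr => r _; rewrite (mulrC (u r)).
- move=> u v z; rewrite -big_split; apply: eq_bigr => r _.
  by rewrite /= -!mulrDl.
- move=> a u v; rewrite mulr_sumr; apply: eq_bigr => r _.
  by rewrite !mulrA.
- by move=> u; apply: sumr_ge0 => r _; rewrite divr_ge0// -expr2 sqr_ge0.
Qed.

Lemma wnorm_le_sup l x (L D : R) : 0 < L -> (forall r, L <= l r) ->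
  (forall r, `|x r| <= D) -> wnorm l x <= D * Num.sqrt (d%:R / L).
Proof.
move=> L0 lL xD.
case: (ltnP 0 d) => [d0|]; last first.
  rewrite leqn0 => /eqP d0.
  have -> : wnorm l x = 0.
    rewrite /wnorm big1 ?sqrtr0// => r _; exfalso.
    by case: r => r; rewrite d0 ltn0.
  by rewrite d0 mul0r sqrtr0 mulr0.
have D0 : 0 <= D by exact: le_trans (xD (Ordinal d0)).
rewrite -{1}[D]ger0_norm// -sqrtr_sqr -sqrtrM ?sqr_ge0// ler_wsqrtr//.
rewrite [leRHS](_ : _ = \sum_(r < d) D ^+ 2 / L); last first.
  by rewrite sumr_const card_ord -mulr_natl; lra.
apply: ler_sum => r _; apply: ler_pM.
- exact: sqr_ge0.
- by rewrite invr_ge0 (le_trans (ltW L0)).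
- by rewrite -[x r ^+ 2]real_normK ?num_real// lerXn2r ?nnegrE.
- by rewrite lef_pV2// posrE (lt_le_trans L0).
Qed.

(** Eigenfunctions can only be estimated up to sign; the statistic does not see
    this ambiguity. *)
Lemma wnorm_sign l x (s : 'I_d -> R) : (forall r, s r = 1 \/ s r = -1) ->
  wnorm l (fun r => s r * x r) = wnorm l x.
Proof.
move=> sE; congr Num.sqrt; apply: eq_bigr => r _; congr (_ / _).
by case: (sE r) => ->; rewrite ?mul1r// mulN1r sqrrN.
Qed.

Lemma wnorm_perturb_arg l p q (s : 'I_d -> R) (L D : R) :
  0 < L -> (forall r, L <= l r) -> (forall r, s r = 1 \/ s r = -1) ->
  (forall r, `|q r - s r * p r| <= D) ->
  `|wnorm l q - wnorm l p| <= D * Num.sqrt (d%:R / L).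
Proof.
move=> L0 lL sE qpD.
have l0 r : 0 <= l r by exact: le_trans (ltW L0) (lL r).
have h1 := wnormD (fun r => s r * p r) (fun r => q r - s r * p r) l0.
have h2 := wnormD q (fun r => s r * p r - q r) l0.
have h3 := wnorm_le_sup L0 lL qpD.
have qpD' r : `|s r * p r - q r| <= D by rewrite distrC.
have h4 := wnorm_le_sup L0 lL qpD'.
rewrite (_ : (fun r => s r * p r + (q r - s r * p r)) = q) in h1; last first.
  by apply/funext => r; ring.
rewrite (_ : (fun r => q r + (s r * p r - q r)) =
  (fun r => s r * p r)) in h2; last first.
  by apply/funext => r; ring.
rewrite !(wnorm_sign _ _ sE) in h1 h2.
by rewrite ler_norml; apply/andP; split; lra.
Qed.

(** Each reciprocal weight changes by a relative error of at most 2 rho / L,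
    hence so does the sum of squares. Dividing the difference of the two squared norms
    by their sum, which is at least [wnorm l q], gives the bound for the norms. *)
Lemma wnorm_perturb_weight l lh q (L rho : R) :
  0 < L -> (forall r, L <= l r) -> (forall r, `|lh r - l r| <= rho) ->
  rho <= L / 2 ->
  `|wnorm lh q - wnorm l q| <= 2 * rho / L * wnorm l q.
Proof.
move=> L0 lL lhl rhoL.
have l0 r : 0 < l r by exact: lt_le_trans L0 (lL r).
have lhL r : L / 2 <= lh r.
  by have := lhl r; have := lL r; rewrite ler_norml => ? /andP[]; lra.
have lh0 r : 0 < lh r by apply: lt_le_trans (lhL r); rewrite divr_gt0.
set A := \sum_r q r ^+ 2 / lh r; set B := \sum_r q r ^+ 2 / l r.
have A0 : 0 <= A by apply: sumr_ge0 => r _; rewrite divr_ge0 ?sqr_ge0// ltW.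
have B0 : 0 <= B by apply: sumr_ge0 => r _; rewrite divr_ge0 ?sqr_ge0// ltW.
have AB : `|A - B| <= 2 * rho / L * B.
  rewrite -sumrB mulr_sumr (le_trans (ler_norm_sum _ _ _))//.
  apply: ler_sum => r _.
  rewrite (_ : _ - _ = q r ^+ 2 / l r * ((l r - lh r) / lh r)); last first.
    by field; rewrite !gt_eqF.
  have ql0 : 0 <= q r ^+ 2 / l r by rewrite divr_ge0 ?sqr_ge0// ltW.
  rewrite normrM (ger0_norm ql0) [leRHS]mulrC; apply: ler_wpM2l => //.
  rewrite normrM distrC (_ : 2 * rho / L = rho * (L / 2)^-1); last first.
    by field; rewrite gt_eqF.
  have lhV0 : 0 <= (lh r)^-1 by rewrite invr_ge0 ltW.
  rewrite (ger0_norm lhV0); apply: ler_pM => //.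
  by rewrite lef_pV2 ?posrE ?divr_gt0.
rewrite /wnorm -/A -/B.
have [B_eq0|B_neq0] := eqVneq B 0.
  move: AB; rewrite B_eq0 mulr0 subr0 normr_le0 => /eqP ->.
  by rewrite sqrtr0 subrr normr0 mulr0.
have sB0 : 0 < Num.sqrt B by rewrite sqrtr_gt0 lt_def B_neq0.
rewrite -(ler_pM2r sB0) -[leRHS]mulrA -[in leRHS]expr2 sqr_sqrtr//.
apply: le_trans AB.
rewrite -{2}(sqr_sqrtr A0) -{3}(sqr_sqrtr B0) subr_sqr normrM.
apply: ler_wpM2l => //; rewrite ger0_norm ?addr_ge0 ?sqrtr_ge0//.
by rewrite lerDr sqrtr_ge0.
Qed.

Lemma wnorm_perturb l lh p q (s : 'I_d -> R) (L rho D e : R) :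
  0 < L -> (forall r, L <= l r) -> (forall r, `|lh r - l r| <= rho) ->
  0 <= rho <= L / 2 -> (forall r, s r = 1 \/ s r = -1) ->
  (forall r, `|q r - s r * p r| <= D) -> D * Num.sqrt (d%:R / L) <= e ->
  `|wnorm lh q - wnorm l p| <= e + 2 * rho / L * (wnorm l p + e).
Proof.
move=> L0 lL lhl /andP[rho0 rhoL] sE qpD De.
have h1 := le_trans (wnorm_perturb_arg L0 lL sE qpD) De.
have h2 := wnorm_perturb_weight q L0 lL lhl rhoL.
apply: (le_trans (ler_distD (wnorm l q) _ _)).
rewrite [leLHS]addrC; apply: lerD => //; apply: (le_trans h2).
apply: ler_wpM2l; first by rewrite divr_ge0 ?mulr_ge0// ltW.
by move: h1; rewrite ler_norml => /andP[]; lra.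
Qed.

End weighted_l2.

Lemma le_bigmax_dist {R : realType} (I : Type) (s : seq I) (P : pred I)
    (f g : I -> R) (e : R) : 0 <= e ->
  (forall i, P i -> `|f i - g i| <= e) ->
  `|\big[Num.max/0]_(i <- s | P i) f i - \big[Num.max/0]_(i <- s | P i) g i|
    <= e.
Proof.
move=> e0 fg; elim/big_ind2 : _ => [|x a y b xa yb|//]; first by rewrite subrr normr0.
move: xa yb; rewrite !ler_norml => /andP[? ?] /andP[? ?].
by rewrite /Num.max; case: ifPn; case: ifPn; rewrite -?leNgt => ? ?; lra.
Qed.

(** * Deterministic perturbation of the statistic *)

Section partial_sums.
Context {R : realType}.
Implicit Types (Z u : nat -> L2 R) (n k r : nat).

Definition psum Z k : L2 R := \sum_(1 <= i < k.+1) Z i.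

(** The centred partial sums: their scores are the statistics [eta_stat]. *)
Definition bridge Z n k : L2 R := psum Z k - (k%:R / n%:R) *: psum Z n.

Lemma eta_statE Z u n k r :
  eta_stat Z u n k r = (Num.sqrt n%:R)^-1 * dot (bridge Z n k) (u r).
Proof.
rewrite /eta_stat /bridge sumrB sumr_const_nat subSS subn0.
by rewrite /Zbar -(scaler_nat k (_ *: _)) scalerA.
Qed.

(** A mean that is constant up to time n cancels in [bridge]; it need only be
    constant up to null sets because inner products ignore them. *)
Lemma eta_stat_shift (mu Z : nat -> L2 R) u n k r :
  (0 < n)%N -> (k <= n)%N -> H0 mu n ->
  eta_stat (fun i => mu i + Z i) u n k r = eta_stat Z u n k r.
Proof.
move=> n0 kn h0; rewrite !eta_statE; congr (_ * _).
have psumD m : psum (fun i => mu i + Z i) m = psum mu m + psum Z m.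
  exact: big_split.
have dot_psum m : (m <= n)%N -> dot (psum mu m) (u r) = m%:R * dot (mu 1) (u r).
  move=> mn; rewrite dot_suml (eq_big_nat _ _ (F2 := fun=> dot (mu 1) (u r))).
    by rewrite sumr_const_nat subSS subn0 mulr_natl.
  move=> i /andP[i1 im]; apply: dot_ae; apply: h0; last by rewrite n0.
  by rewrite i1 (leq_trans _ mn).
rewrite /bridge !psumD !dotDl !dotNl !dotZl !dotDl !dot_psum//.
have : n%:R != 0 :> R by rewrite pnatr_eq0 -lt0n.
by move=> n_neq0; field.
Qed.

Lemma psum_rev Z n k : (k <= n)%N ->
  psum (fun i => Z (n.+1 - i)%N) (n - k) = psum Z n - psum Z k.
Proof.
move=> kn; rewrite /psum (@big_cat_nat _ _ _ k.+1 1 n.+1)//=.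
rewrite [RHS]addrAC subrr add0r.
rewrite [RHS]big_nat_rev/= -{1}(add1n k) big_addn.
rewrite (_ : n.+1 - k = (n - k).+1)%N; last by rewrite subSn.
apply: eq_big_nat => i /andP[i1 ink]; congr (Z _).
lia.
Qed.

Lemma le_partial_norm_max Z n k : (1 <= k < n)%N ->
  L2norm (psum Z k) <= Num.sqrt k%:R * partial_norm_max Z n.
Proof.
move=> kn; have k0 : 0 < Num.sqrt k%:R :> R.
  by rewrite sqrtr_gt0 ltr0n; case/andP: kn.
rewrite mulrC -ler_pdivrMr// mulrC.
by apply: (@bigmax_sup_seq _ _ _ _ _ k) => //; rewrite mem_index_iota.
Qed.

(** With m = n - k one has
    S_k - (k/n) S_n = (m/n) S_k - (k/n) (S_n - S_k) and
    w(k/n) = n / sqrt (k m), so the two terms get the factors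
    sqrt (m/n) / sqrt k and sqrt (k/n) / sqrt m; moreover m/n and k/n are at
    most 1. The remainder S_n - S_k is a partial sum of length m of the reversed
    sequence. *)
Lemma bridge_le Z n k : (1 <= k < n)%N ->
  weight (k%:R / n%:R) * (Num.sqrt n%:R)^-1 * L2norm (bridge Z n k) <=
  partial_norm_max Z n + partial_norm_max (fun i => Z (n.+1 - i)%N) n.
Proof.
move=> /andP[k1 kn].
have bZ : (1 <= n - k < n)%N by lia.
have kZ : (1 <= k < n)%N by rewrite k1.
have := le_partial_norm_max (fun i => Z (n.+1 - i)%N) bZ.
have := le_partial_norm_max Z kZ.
rewrite psum_rev; last exact: ltnW.
set F := partial_norm_max _ _; set G := partial_norm_max _ _.
have F0 : 0 <= F by exact: bigmax_ge_id.
have G0 : 0 <= G by exact: bigmax_ge_id.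
have nE : n%:R = k%:R + (n - k)%:R :> R by rewrite -natrD subnKC// ltnW.
have k0 : 0 < k%:R :> R by rewrite ltr0n.
have m0 : 0 < (n - k)%:R :> R by rewrite ltr0n subn_gt0.
have n0 : 0 < n%:R :> R by rewrite ltr0n (leq_trans _ kn).
rewrite /bridge (_ : psum Z k - (k%:R / n%:R) *: psum Z n =
  ((n - k)%:R / n%:R) *: psum Z k + (- (k%:R / n%:R)) *: (psum Z n - psum Z k)); last first.
  rewrite (_ : (n - k)%:R / n%:R = 1 - k%:R / n%:R); last first.
    by rewrite nE; field; rewrite -nE gt_eqF.
  by rewrite scalerBl scale1r scalerBr !scaleNr opprK [- _ + _]addrC addrA subrK.
set A := psum Z k; set B := psum Z n - psum Z k.
have := L2normD (((n - k)%:R / n%:R) *: A) ((- (k%:R / n%:R)) *: B).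
rewrite !L2normZ normrN !ger0_norm ?divr_ge0//.
set X := L2norm (_ + _) => hX hA hB.
have wE : weight (k%:R / n%:R) =
    n%:R / (Num.sqrt k%:R * Num.sqrt (n - k)%:R) :> R.
  rewrite /weight (_ : k%:R / n%:R * (1 - k%:R / n%:R) =
      n%:R ^- 2 * (k%:R * (n - k)%:R)); last first.
    by rewrite nE; field; rewrite -nE gt_eqF.
  rewrite sqrtrM ?invr_ge0 ?sqr_ge0// sqrtrV ?sqr_ge0// sqrtr_sqr gtr0_norm//.
  by rewrite sqrtrM// invfM invrK.
rewrite wE.
have : Num.sqrt k%:R <= Num.sqrt n%:R :> R by rewrite ler_wsqrtr// ler_nat ltnW.
have : Num.sqrt (n - k)%:R <= Num.sqrt n%:R :> R by rewrite ler_wsqrtr// ler_nat leq_subr.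
have := sqr_sqrtr (ltW n0); have := sqr_sqrtr (ltW k0); have := sqr_sqrtr (ltW m0).
have : 0 < Num.sqrt k%:R :> R by rewrite sqrtr_gt0.
have : 0 < Num.sqrt (n - k)%:R :> R by rewrite sqrtr_gt0.
have : 0 < Num.sqrt n%:R :> R by rewrite sqrtr_gt0.
move: hX hA hB.
set c := Num.sqrt n%:R; set b := Num.sqrt (n - k)%:R; set a := Num.sqrt k%:R.
move=> hX hA hB c0 b0 a0 b2 a2 c2 bc ac.
have hX' : X <= b ^+ 2 / c ^+ 2 * (a * F) + a ^+ 2 / c ^+ 2 * (b * G).
  apply: (le_trans hX); rewrite b2 a2 c2.
  by apply: lerD; apply: ler_wpM2l => //; rewrite divr_ge0.
apply: (@le_trans _ _ (n%:R / (a * b) / c *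
    (b ^+ 2 / c ^+ 2 * (a * F) + a ^+ 2 / c ^+ 2 * (b * G)))).
  by apply: ler_wpM2l => //; rewrite !divr_ge0 ?mulr_ge0// ltW.
rewrite -c2 [leLHS](_ : _ = b / c * F + a / c * G); last first.
  by field; rewrite !gt_eqF.
by apply: lerD; apply: ler_piMl => //; rewrite ler_pdivrMr// mul1r.
Qed.

Lemma eta_stat_perturb Z (u v : nat -> L2 R) n k r (s : R) : (1 <= k < n)%N ->
  `|weight (k%:R / n%:R) * eta_stat Z u n k r
    - s * (weight (k%:R / n%:R) * eta_stat Z v n k r)| <=
  (partial_norm_max Z n + partial_norm_max (fun i => Z (n.+1 - i)%N) n)
  * L2norm (u r - s *: v r).
Proof.
move=> kn; rewrite !eta_statE; set w := weight _; set c := _^-1.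
set b := bridge _ _ _.
have -> : w * (c * dot b (u r)) - s * (w * (c * dot b (v r))) =
    w * c * dot b (u r - s *: v r).
  rewrite [dot b (u r - _)]dotC dotDl dotNl dotZl.
  by rewrite (dotC (u r)) (dotC (v r)); ring.
have w0 : 0 <= w * c by rewrite mulr_ge0// invr_ge0 sqrtr_ge0.
rewrite normrM (ger0_norm w0).
apply: (le_trans (ler_wpM2l w0 (norm_dot_le _ _))).
by rewrite mulrA; apply: ler_wpM2r; [exact: L2norm_ge0|exact: bridge_le].
Qed.

Definition maxstat d n Z u (l : nat -> R) : R :=
  \big[Num.max/0]_(1 <= k < n)
     (weight (k%:R / n%:R) *
      Num.sqrt (\sum_(r < d) eta_stat Z u n k r ^+ 2 / l r)).

Lemma TstatE d n Z u l : (forall r, (r < d)%N -> 0 < l r) ->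
  Tstat d n Z u l = (maxstat d n Z u l)%:E.
Proof.
move=> l0; rewrite /Tstat ifN//; apply/existsPn => r.
by rewrite gt_eqF// l0.
Qed.

(** The deterministic heart of the proof: [F * Delta] bounds the weighted error
    in the scores, uniformly in k, and [e] its effect on the statistic; the
    second summand is the relative error due to the eigenvalues. *)
Lemma maxstat_perturb d n Z (u v : nat -> L2 R) (l lh : nat -> R)
    (s : 'I_d -> R) (L rho F Delta e : R) :
  0 < L -> (forall r, (r < d)%N -> L <= l r) ->
  (forall r : 'I_d, `|lh r - l r| <= rho) -> 0 <= rho <= L / 2 ->
  (forall r : 'I_d, s r = 1 \/ s r = -1) ->
  partial_norm_max Z n + partial_norm_max (fun i => Z (n.+1 - i)%N) n <= F ->
  0 <= Delta -> (forall r : 'I_d, L2norm (u r - s r *: v r) <= Delta) ->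
  F * Delta * Num.sqrt (d%:R / L) <= e ->
  `|maxstat d n Z u lh - maxstat d n Z v l|
    <= e + 2 * rho / L * (maxstat d n Z v l + e).
Proof.
move=> L0 lL lhl rhoL sE FE D0 uv De.
have F0 : 0 <= F.
  by apply: le_trans FE; apply: addr_ge0; exact: bigmax_ge_id.
have e0 : 0 <= e by apply: le_trans De; rewrite !mulr_ge0// sqrtr_ge0.
have kap0 : 0 <= 2 * rho / L.
  by case/andP: rhoL => r0 _; rewrite !mulr_ge0// invr_ge0 ltW.
have T0 : 0 <= maxstat d n Z v l by exact: bigmax_ge_id.
rewrite {1 2}/maxstat !big_nat; apply: le_bigmax_dist => [|k kn].
  by rewrite addr_ge0// mulr_ge0// addr_ge0.
set w := weight _.
have w0 : 0 <= w by rewrite invr_ge0 sqrtr_ge0.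
have wnE (v' : nat -> L2 R) (l' : nat -> R) :
  w * Num.sqrt (\sum_(r < d) eta_stat Z v' n k r ^+ 2 / l' r) =
  wnorm (fun r : 'I_d => l' r) (fun r : 'I_d => w * eta_stat Z v' n k r).
  by rewrite -wnormM.
have qp (r : 'I_d) : `|w * eta_stat Z u n k r - s r * (w * eta_stat Z v n k r)|
   <= F * Delta.
  apply: (le_trans (eta_stat_perturb _ _ _ _ _ kn)).
  by apply: ler_pM => //; [apply: addr_ge0; exact: bigmax_ge_id|exact: L2norm_ge0].
rewrite !wnE.
have := wnorm_perturb L0 (fun r : 'I_d => lL _ (ltn_ord r)) lhl rhoL sE qp De.
move=> /le_trans; apply; rewrite lerD2l ler_wpM2l// lerD2r.
rewrite -wnE; apply: (@bigmax_sup_seq _ _ _ _ _ k) => //; by rewrite mem_index_iota.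
Qed.

End partial_sums.

(** * Measurability *)

Section measurability.
Context {R : realType} {disp : measure_display} {Omega : measurableType disp}.

Lemma measurable_sqrtr (f : Omega -> R) : measurable_fun setT f ->
  measurable_fun setT (fun w => Num.sqrt (f w)).
Proof.
move=> mf; apply: measurableT_comp mf; apply: continuous_measurable_fun.
exact: sqrt_continuous.
Qed.

Lemma measurable_invr (f : Omega -> R) : (forall w, 0 <= f w) ->
  measurable_fun setT f -> measurable_fun setT (fun w => (f w)^-1).
Proof.
move=> f0 mf; rewrite (_ : (fun w => _) = (fun w => f w `^ (-1))); last first.
  by apply/funext => w; rewrite powR_inv1.
exact: (measurableT_comp (measurable_powR _)).
Qed.

Lemma measurable_bigmax (I : Type) (s : seq I) (f : I -> Omega -> R) :
  (forall i, measurable_fun setT (f i)) ->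
  measurable_fun setT (fun w => \big[Num.max/0]_(i <- s) f i w).
Proof.
move=> mf; elim: s => [|i s IH].
  by under eq_fun do rewrite big_nil; exact: measurable_cst.
by under eq_fun do rewrite big_cons; exact: measurable_maxr.
Qed.

Lemma measurable_dot_psum (Z : nat -> Omega -> L2 R) (W : Omega -> L2 R) k :
  (forall i, jointly_measurable (Z i)) -> jointly_measurable W ->
  measurable_fun setT (fun w => dot (psum (Z ^~ w) k) (W w)).
Proof.
move=> mZ mW; under eq_fun do rewrite dot_suml.
by apply: measurable_sum => i; exact: measurable_dot.
Qed.

Lemma measurable_eta_stat (Z u : nat -> Omega -> L2 R) n k r :
  (forall i, jointly_measurable (Z i)) -> (forall i, jointly_measurable (u i)) ->
  measurable_fun setT (fun w => eta_stat (Z ^~ w) (u ^~ w) n k r).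
Proof.
move=> mZ mu; under eq_fun do rewrite eta_statE dotDl dotNl dotZl.
apply: measurable_funM => //; apply: measurable_funB.
  exact: measurable_dot_psum.
by apply: measurable_funM => //; exact: measurable_dot_psum.
Qed.

Lemma measurable_Tstat d n (Z u : nat -> Omega -> L2 R) (l : nat -> Omega -> R) :
  (forall i, jointly_measurable (Z i)) -> (forall i, jointly_measurable (u i)) ->
  (forall i, measurable_fun setT (l i)) -> (forall i w, 0 <= l i w) ->
  measurable_fun setT (fun w => Tstat d n (Z ^~ w) (u ^~ w) (l ^~ w)).
Proof.
move=> mZ mu ml l0; apply: measurable_fun_ifT => //.
  (* The existential condition says that the product of the l r vanishes. *)
  rewrite (_ : (fun w => _) = (fun w => \prod_(r < d) l r w == 0)); last first.
    apply/funext => w; apply/existsP/eqP => [[r /eqP lr]|/eqP].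
      by rewrite (bigD1 r)//= lr mul0r.
    by rewrite prodf_seq_eq0 => /hasP[r _ /= lr]; exists r.
  by apply: measurable_fun_eqr => //; apply: measurable_prod => r _; exact: ml.
apply/measurable_EFinP; apply: measurable_bigmax => k.
apply: measurable_funM => //; apply: measurable_sqrtr; apply: measurable_sum => r.
apply: measurable_funM; last exact: measurable_invr.
by apply: measurable_funX; exact: measurable_eta_stat.
Qed.

Lemma measurable_normalized d n (T : Omega -> \bar R) :
  measurable_fun setT T -> measurable_fun setT (fun w => normalized d n (T w)).
Proof.
move=> mT; apply: emeasurable_funB => //; exact: emeasurable_funM.
Qed.

Lemma measurable_partial_norm_max n (Z : nat -> Omega -> L2 R) :
  (forall i, jointly_measurable (Z i)) ->
  measurable_fun setT (fun w => partial_norm_max (Z ^~ w) n).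
Proof.
move=> mZ; apply: measurable_bigmax => k; apply: measurable_funM => //.
under eq_fun do rewrite L2normE; apply: measurable_sqrtr.
under eq_fun do rewrite dot_suml.
apply: measurable_sum => i; under eq_fun do rewrite dotC.
exact: measurable_dot_psum.
Qed.

Lemma jointly_measurable_cst (f : L2 R) : jointly_measurable (fun _ : Omega => f).
Proof.
apply: measurable_funTS => /=.
by apply: (@measurableT_comp _ _ _ _ _ _ (f : measurableTypeR R -> R)).
Qed.

Lemma measurable_L2norm_sub (Z : Omega -> L2 R) (s : Omega -> R) (f : L2 R) :
  jointly_measurable Z -> measurable_fun setT s ->
  measurable_fun setT (fun w => L2norm (Z w - s w *: f)).
Proof.
move=> mZ ms; have mf := jointly_measurable_cst f.
under eq_fun => w.
  rewrite L2normE dotDl dotNl dotZl [dot _ (_ - _)]dotC [dot f (_ - _)]dotC.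
  rewrite !dotDl !dotNl !dotZl; over.
apply: measurable_sqrtr; apply: measurable_funB; last apply: measurable_funM => //.
  apply: measurable_funB; first exact: measurable_dot.
  by apply: measurable_funM => //; exact: measurable_dot.
apply: measurable_funB; first exact: measurable_dot.
by apply: measurable_funM => //; exact: measurable_dot.
Qed.

Lemma measurable_set_gt (f : Omega -> R) c : measurable_fun setT f ->
  measurable [set w | c < f w].
Proof.
move=> mf; rewrite -[X in measurable X]setTI; under eq_set do rewrite -lte_fin.
by apply: emeasurable_fun_o_infty => //; exact/measurable_EFinP.
Qed.

Lemma measurable_set_lee (f : Omega -> \bar R) c : measurable_fun setT f ->
  measurable [set w | (f w <= c)%E].
Proof.
by move=> mf; rewrite -[X in measurable X]setTI; exact: emeasurable_fun_infty_c.
Qed.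

End measurability.

(** * Time reversal by stationarity *)

Section stationarity.
Context {R : realType} {disp : measure_display} {Omega : measurableType disp}.
Context (P : probability Omega R).

Lemma eq_partial_norm_max (Z W : nat -> L2 R) n :
  (forall i, (1 <= i < n)%N -> Z i = W i) ->
  partial_norm_max Z n = partial_norm_max W n.
Proof.
move=> ZW; apply: eq_big_nat => k /andP[k1 kn]; congr (_ * L2norm _).
by apply: eq_big_nat => i /andP[i1 ik]; apply: ZW; rewrite i1 (leq_trans ik).
Qed.

(** Continuity of the maximum in the L2 topology: partial sums of fewer than n
    terms, each within e, differ by at most n e, and k^(-1/2) is at most 1. *)
Lemma partial_norm_max_lip (Z W : nat -> L2 R) n e : 0 <= e ->
  (forall i, (1 <= i < n)%N -> L2norm (Z i - W i) <= e) ->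
  `|partial_norm_max Z n - partial_norm_max W n| <= n%:R * e.
Proof.
move=> e0 ZWe; rewrite /partial_norm_max !big_nat; apply: le_bigmax_dist => [|k kn].
  by rewrite mulr_ge0.
have [k1 kn'] := andP kn.
have sub_le (A B : nat -> L2 R) :
    (forall i, (1 <= i < n)%N -> L2norm (A i - B i) <= e) ->
    L2norm (psum A k) - L2norm (psum B k) <= k%:R * e.
  move=> ABe; rewrite lerBlDr -[psum A k](subrK (psum B k)).
  apply: (le_trans (L2normD _ _)); rewrite lerD2r /psum -sumrB.
  have -> : k%:R * e = \sum_(1 <= i < k.+1) e.
    by rewrite sumr_const_nat subSS subn0 mulr_natl.
  rewrite big_nat [leRHS]big_nat.
  elim/big_ind2 : _ => [|x a y b xa yb|i /andP[i1 ik]].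
  - by rewrite -(scale0r 0) L2normZ normr0 mul0r.
  - by apply: (le_trans (L2normD _ _)); exact: lerD.
  - by apply: ABe; rewrite i1 (leq_trans _ kn').
have s1 : 1 <= Num.sqrt k%:R :> R by rewrite -[leLHS]sqrtr1 ler_wsqrtr// ler1n.
have s0 : 0 < Num.sqrt k%:R :> R by exact: lt_le_trans s1.
rewrite -mulrBr normrM ger0_norm ?invr_ge0 ?sqrtr_ge0//.
rewrite ler_pdivrMl//; apply: (@le_trans _ _ (k%:R * e)).
  rewrite ler_norml; apply/andP; split; last exact: sub_le.
  rewrite lerNl opprB; apply: sub_le => i i1; rewrite -opprB -scaleN1r L2normZ.
  by rewrite normrN1 mul1r; exact: ZWe.
rewrite -[leLHS]mul1r; apply: ler_pM => //; first by rewrite mulr_ge0.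
by apply: ler_wpM2r => //; rewrite ler_nat ltnW.
Qed.

(** The vectors Y_n, ..., Y_1 and Y_(-1), ..., Y_(-n) have the same law, being
    translates of each other by n + 1, and the event is open in the vector. *)
Lemma stationary_partial_norm_max (Y : int -> Omega -> L2 R) n c :
  strictly_stationary P Y ->
  P [set w | c < partial_norm_max (fun i => Y (n.+1 - i)%N%:Z w) n] =
  P [set w | c < partial_norm_max (fun i => Y (- i%:Z) w) n].
Proof.
case: n => [|n] stat.
  by congr (P _); apply/seteqP; split => w; rewrite /= /partial_norm_max !big_geq.
pose B : set ('I_n.+1 -> L2 R) :=
  [set f | c < partial_norm_max (fun i => f (inord i)) n.+1].
have oB : L2open_tuple B.
  move=> f cf.
  pose e := (partial_norm_max (fun i => f (inord i)) n.+1 - c) / n.+2%:R.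
  have e0 : 0 < e by rewrite divr_gt0// subr_gt0.
  exists e => // g ge; rewrite /B /=.
  have := @partial_norm_max_lip (fun i => g (inord i)) (fun i => f (inord i))
    n.+1 e (ltW e0).
  have ge' i : (1 <= i < n.+1)%N -> L2norm (g (inord i) - f (inord i)) <= e.
    by move=> _; apply: ltW.
  move=> /(_ ge'); rewrite ler_norml => /andP[+ _].
  have : n.+2%:R * e = partial_norm_max (fun i => f (inord i)) n.+1 - c.
    by rewrite mulrC divfK// pnatr_eq0.
  rewrite -[n.+2]addn1 natrD mulrDl mul1r; lra.
have h := stat n.+1 (fun j : 'I_n.+1 => - j%:Z) n.+2%:Z B (sub_gen_smallest oB).
have shiftE w : partial_norm_max (fun i => Y (n.+2 - i)%N%:Z w) n.+1 =
    partial_norm_max (fun i => Y (- (inord i : 'I_n.+1)%:Z + n.+2%:Z) w) n.+1.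
  apply: eq_partial_norm_max => i /andP[i1 ik].
  by congr (Y _ w); rewrite inordK; lia.
have backE w : partial_norm_max (fun i => Y (- i%:Z) w) n.+1 =
    partial_norm_max (fun i => Y (- (inord i : 'I_n.+1)%:Z) w) n.+1.
  apply: eq_partial_norm_max => i /andP[i1 ik].
  by congr (Y _ w); rewrite inordK; lia.
under eq_set do rewrite shiftE.
by under [in RHS]eq_set do rewrite backE.
Qed.

End stationarity.

(** * Asymptotics of the normalizing functions *)

Section limits.
Context {R : realType}.

Lemma cvge0_near_le (u : nat -> \bar R) (e : R) :
  u n @[n --> \oo] --> 0%E -> 0 < e -> \forall n \near \oo, (u n <= e%:E)%E.
Proof.
move=> /fine_cvgP[ufin u0] e0.
have : \forall n \near \oo, `|0 - fine (u n)| <= e by move: e e0; apply/cvgrPdist_le.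
move: ufin; apply: filterS2 => n ufin.
by rewrite sub0r normrN -{2}(fineK ufin) lee_fin; apply: le_trans; exact: ler_norm.
Qed.

Lemma near_ge_lnln (A : R) : \forall n \near \oo, A <= ln (ln (n%:R : R)).
Proof.
have := nbhs_infty_ger (expR (expR A)); apply: filterS => n An.
have lnA : expR A <= ln (n%:R : R).
  by rewrite -[leLHS]expRK ler_ln ?posrE ?expR_gt0// (lt_le_trans _ An)// expR_gt0.
by rewrite -[leLHS]expRK ler_ln ?posrE ?expR_gt0// (lt_le_trans _ lnA)// expR_gt0.
Qed.

(** The leading term of b_d(log n) is 2 log log n; the constant 3 + d is a crude
    bound for all the terms together. *)
Lemma near_bnorm_le d (x : R) :
  \forall n \near \oo, x + bnorm d (ln (n%:R : R)) <= (3 + d%:R) * ln (ln n%:R).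
Proof.
have := near_ge_lnln (x - ln (Gamma (d%:R / 2))); have := near_ge_lnln 1.
apply: filterS2 => n; rewrite /bnorm; set l := ln (ln _) => l1 lx.
have lnl : ln l <= l.
  by have := @le_ln1Dx _ (l - 1); rewrite (_ : 1 + (l - 1) = l); [lra|ring].
have : 0 <= d%:R :> R by [].
set D : R := d%:R; set G := ln (Gamma _) in lx *; nra.
Qed.

(** Tightness of the limit law from above. *)
Lemma gumbel_tight (e : R) : 0 < e -> exists x, 1 - e < expR (- 2 * expR (- x)).
Proof.
move=> e0; exists (- ln (e / 4)).
rewrite opprK lnK ?posrE ?divr_gt0//.
by have := expR_ge1Dx (- 2 * (e / 4)); lra.
Qed.

Lemma continuous_gumbel (x : R) :
  {for x, continuous (fun x : R => expR (- 2 * expR (- x)))}.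
Proof.
apply: (@continuous_comp _ _ _ (fun x : R => - 2 * expR (- x)) (@expR R));
  last exact: continuous_expR.
apply: cvgM; first exact: cvg_cst.
apply: (@continuous_comp _ _ _ (@GRing.opp R) (@expR R));
  last exact: continuous_expR.
exact: opp_continuous.
Qed.

(** Here [l] is log log n, so that [Num.sqrt (2 * l)] is a(log n). The first
    error is scaled by a(log n) / sqrt l = sqrt 2. In the second, the factor
    1 / l absorbs a(log n) T, which is at most C l. What remains is a multiple of
    [e2]. *)
Lemma scaled_close (l L K C e2 delta T Th : R) :
  1 <= l -> 0 < L -> 0 <= K -> 0 <= C -> 0 <= e2 <= 1 ->
  Num.sqrt (2 * l) * T <= C * l ->
  `|Th - T| <= e2 * K / Num.sqrt l
      + 2 * (e2 * l^-1) / L * (T + e2 * K / Num.sqrt l) ->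
  e2 * (Num.sqrt 2 * K + 2 * C / L + 2 * (Num.sqrt 2 * K) / L) <= delta ->
  `|Num.sqrt (2 * l) * Th - Num.sqrt (2 * l) * T| <= delta.
Proof.
move=> l1 L0 K0 C0 /andP[e20 e21] aT hT; apply: le_trans.
have l0 : 0 < l by exact: lt_le_trans l1.
have sl0 : 0 < Num.sqrt l by rewrite sqrtr_gt0.
have aE : Num.sqrt (2 * l) = Num.sqrt 2 * Num.sqrt l by rewrite sqrtrM.
set K' := Num.sqrt 2 * K.
have K'0 : 0 <= K' by rewrite mulr_ge0// sqrtr_ge0.
rewrite -mulrBr normrM ger0_norm ?sqrtr_ge0//.
apply: (le_trans (ler_wpM2l (sqrtr_ge0 _) hT)).
have -> : Num.sqrt (2 * l) * (e2 * K / Num.sqrt l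
      + 2 * (e2 * l^-1) / L * (T + e2 * K / Num.sqrt l)) =
   e2 * (K' + (2 / L) * (l^-1 * (Num.sqrt (2 * l) * T)) + (2 / L) * (l^-1 * e2 * K')).
  by rewrite aE /K'; field; rewrite !gt_eqF.
apply: ler_wpM2l => //; rewrite -!addrA lerD2l; apply: lerD.
  rewrite [leRHS](_ : _ = 2 / L * C); last by ring.
  apply: ler_wpM2l; first by rewrite divr_ge0// ltW.
  by rewrite ler_pdivrMl// [leRHS]mulrC.
rewrite [leRHS](_ : _ = 2 / L * K'); last by ring.
apply: ler_wpM2l; first by rewrite divr_ge0// ltW.
apply: ler_piMl => //; rewrite ler_pdivrMl// mulr1; exact: le_trans l1.
Qed.

End limits.

(** * Transfer of the limit law *)

Section slutsky.
Context {R : realType} {disp : measure_display} {Omega : measurableType disp}.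
Context (P : probability Omega R).

(** Slutsky's lemma in the form needed for extended real statistics: if the two
    variables are within delta outside an event of small probability, the two
    distribution functions interlace up to shifts by delta. *)
Lemma cvg_distr_close (F : R -> R) (T That : nat -> Omega -> \bar R) x :
  (forall n, measurable_fun setT (T n)) ->
  (forall n, measurable_fun setT (That n)) ->
  {for x, continuous F} ->
  (forall y, P [set w | (T n w <= y%:E)%E] @[n --> \oo] --> (F y)%:E) ->
  (forall delta e : R, 0 < delta -> 0 < e -> \forall n \near \oo,
    exists N, [/\ measurable N, (P N <= e%:E)%E & forall w, ~ N w ->
      (T n w <= That n w + delta%:E /\ That n w <= T n w + delta%:E)%E]) ->
  P [set w | (That n w <= x%:E)%E] @[n --> \oo] --> (F x)%:E.
Proof.
move=> mT mTh Fx TF close.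
pose p y n := fine (P [set w | (T n w <= y%:E)%E]).
pose q n := fine (P [set w | (That n w <= x%:E)%E]).
have mTy n y : measurable [set w | (T n w <= y%:E)%E] by exact: measurable_set_lee.
have mThy n y : measurable [set w | (That n w <= y%:E)%E] by exact: measurable_set_lee.
have finP A : measurable A -> P A \is a fin_num by move=> mA; exact: fin_num_measure.
have pF y : p y n @[n --> \oo] --> F y by apply: fine_cvg; exact: TF.
apply/fine_cvgP; split; first by apply: nearW => n; exact: finP.
apply/cvgrPdist_le => /= e e0.
have e30 : 0 < e / 3 by rewrite divr_gt0.
have [delta delta0 Fdelta] : exists2 delta, 0 < delta &
    forall y, `|x - y| <= delta -> `|F x - F y| <= e / 3.
  have /cvgrPdist_le/(_ _ e30)/nbhs_ballP[r /= r0 rF] := Fx.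
  exists (r / 2); first by rewrite divr_gt0.
  move=> y xy; apply: rF; rewrite /ball/=; apply: le_lt_trans xy _.
  by rewrite ltr_pdivrMr// ltr_pMr// ltr1n.
have hp : \forall n \near \oo, `|F (x + delta) - p (x + delta) n| <= e / 3.
  by move: (e / 3) e30; apply/cvgrPdist_le; exact: pF.
have hm : \forall n \near \oo, `|F (x - delta) - p (x - delta) n| <= e / 3.
  by move: (e / 3) e30; apply/cvgrPdist_le; exact: pF.
have Fp := Fdelta (x + delta); have Fm := Fdelta (x - delta).
move: (close _ _ delta0 e30) hp hm; apply: filterS3 => n [N [mN PN TTh]].
have le_union A B : measurable A -> measurable B -> A `<=` B `|` N ->
    fine (P A) <= fine (P B) + e / 3.
  move=> mA mB AB; rewrite -lee_fin EFinD !fineK ?finP//.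
  apply: (@le_trans _ _ (P (B `|` N))).
    by apply: le_measure; rewrite ?inE//; exact: measurableU.
  apply: (le_trans (measureU2 _ mB mN)); exact: leeD2l.
have qp : q n <= p (x + delta) n + e / 3.
  apply: le_union => // w Thw; have [Nw|Nw] := pselect (N w); [by right|left].
  rewrite /= EFinD; apply: (le_trans (TTh w Nw).1); exact: leeD2r.
have pq : p (x - delta) n <= q n + e / 3.
  apply: le_union => // w Tw; have [Nw|Nw] := pselect (N w); [by right|left].
  apply: (le_trans (TTh w Nw).2); apply: (le_trans (leeD2r _ Tw)).
  by rewrite -EFinD lee_fin subrK.
have d1 : `|x - (x + delta)| <= delta.
  by rewrite opprD addrA subrr sub0r normrN gtr0_norm.
have d2 : `|x - (x - delta)| <= delta.
  by rewrite opprB addrCA subrr addr0 gtr0_norm.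
move: (Fp d1) (Fm d2).
rewrite -/(q n) !ler_norml.
move=> /andP[? ?] /andP[? ?] /andP[? ?] /andP[? ?]; apply/andP; split; lra.
Qed.

End slutsky.

Theorem theorem3p4 (R : realType) (disp : measure_display)
  (Omega : measurableType disp) (P : probability Omega R)
  (* model *)
  (Y : int -> Omega -> L2 R) (mu : nat -> L2 R)
  (Y_random : forall i, random_element (Y i))
  (Y_centered : centered P Y)
  (Y_stationary : strictly_stationary P Y)
  (nu : R) (nu_gt2 : 2 < nu)
  (Y_moment : ('E_P[fun w => (L2norm (Y 1 w) `^ nu)%R] < +oo)%E)
  (* long run covariance *)
  (d : nat) (d_gt0 : (0 < d)%N)
  (zeta : R * R -> R) (zetaP : long_run_cov P Y zeta)
  (lam : nat -> R) (v : nat -> L2 R) (lamvP : eigen_system zeta lam v)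
  (lam_gt0 : 0 < lam d.-1)
  (* estimates *)
  (lamhat : nat -> nat -> {RV P >-> R}) (vhat : nat -> nat -> Omega -> L2 R)
  (lamhatP : forall n i w, 0 <= lamhat n i.+1 w <= lamhat n i w)
  (vhat_random : forall n i, random_element (vhat n i))
  (vhat_orthonormal : forall n w, L2orthonormal (fun i => vhat n i w))
  (condL : forall x : R,
    P [set w | (normalized d n (Tstat d n (fun i => Y i%:Z w) v lam)
                  <= x%:E)%E] @[n --> \oo]
      --> (expR (- 2 * expR (- x)))%:E)
  (g : nat -> R) (g_gt0 : forall n, 0 < g n)
  (condP1 : OP P (fun n w => partial_norm_max (fun i => Y i%:Z w) n) g)
  (condP1' : OP P (fun n w => partial_norm_max (fun i => Y (- i%:Z) w) n) g)
  (condA1 : (forall n, H0 mu n) ->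
    oP P (fun n w => \big[Num.max/0]_(i < d) `|lamhat n i w - lam i|)
         (fun n => (ln (ln n%:R))^-1))
  (condA2 : (forall n, H0 mu n) ->
    exists s : nat -> 'I_d -> {RV P >-> R},
      (forall n i w, s n i w = 1 \/ s n i w = -1) /\
      oP P (fun n w =>
              \big[Num.max/0]_(i < d) L2norm (vhat n i w - s n i w *: v i))
           (fun n => (Num.sqrt (ln (ln n%:R)))^-1 / g n)) :
  (forall n, H0 mu n) ->
  forall x : R,
    P [set w | (normalized d n
                  (Tstat d n (fun i => observations mu Y i w)
                     (fun i => vhat n i w) (fun i => lamhat n i w))
                  <= x%:E)%E] @[n --> \oo]
      --> (expR (- 2 * expR (- x)))%:E.
Proof.
move=> h0 x.
have l_ge r : (r < d)%N -> lam d.-1 <= lam r.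
  have lamS i j : lam (i + j)%N <= lam i.
    elim: j => [|j IH]; first by rewrite addn0.
    by case: lamvP => /(_ (i + j)%N)/andP[_ h] _ _ _; rewrite addnS (le_trans h).
  by move=> rd; rewrite -[d.-1](subnKC (_ : r <= d.-1)%N)//; lia.
have l_gt0 r : (r < d)%N -> 0 < lam r by move=> /l_ge; exact: lt_le_trans.
have lam_ge0 r : 0 <= lam r.
  by case: lamvP => /(_ r)/andP[h1 h2] _ _ _; exact: le_trans h2.
have Y_meas i : jointly_measurable (Y i) := (Y_random i).2.
have vhat_meas n i : jointly_measurable (vhat n i) := (vhat_random n i).2.
have mT n : measurable_fun setT (fun w =>
    normalized d n (Tstat d n (fun i => Y i%:Z w) v lam)).
  apply: measurable_normalized.
  apply: (@measurable_Tstat _ _ _ d n (fun i => Y i%:Z) (fun i _ => v i)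
    (fun i _ => lam i)).
  - by [].
  - by move=> i; exact: jointly_measurable_cst.
  - by move=> i; exact: measurable_cst.
  - by move=> i _; exact: lam_ge0.
have [s [sE condA2']] := condA2 h0.
have {condA1} condA1 := condA1 h0.
have obsE n w : Tstat d n (fun i => observations mu Y i w) (fun i => vhat n i w)
    (fun i => lamhat n i w) =
    Tstat d n (fun i => Y i%:Z w) (fun i => vhat n i w) (fun i => lamhat n i w).
  rewrite /Tstat; case: ifP => // _; congr (_%:E).
  apply: eq_big_nat => k /andP[k1 kn]; congr (_ * Num.sqrt _).
  apply: eq_bigr => r _; congr (_ ^+ 2 / _).
  apply: (@eta_stat_shift _ mu (fun i => Y i%:Z w)) => //; last exact: ltnW.
  exact: leq_ltn_trans kn.
apply: (@cvg_distr_close _ _ _ P (fun x => expR (- 2 * expR (- x)))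
  (fun n w => normalized d n (Tstat d n (fun i => Y i%:Z w) v lam))).
- by [].
- move=> n; apply: measurable_normalized; under eq_fun do rewrite obsE.
  apply: (@measurable_Tstat _ _ _ d n (fun i => Y i%:Z) (vhat n) (lamhat n)).
  + by [].
  + by [].
  + by move=> i; exact: measurable_funP.
  + by move=> i w; case/andP: (lamhatP n i w) => h1 h2; exact: le_trans h2.
- exact: continuous_gumbel.
- exact: condL.
move=> delta e delta0 e0.
have e50 : 0 < e / 5 by rewrite divr_gt0.
have [M1 M10 P1] := condP1 _ e50.
have [M2 M20 P2] := condP1' _ e50.
have [x0 x0e] := gumbel_tight e50.
(* On the good event the error is at most e2 * Q, where Q collects the constants
   of scaled_close; the bounds 1 and L / 2 keep the error terms linear in e2 and
   the estimated eigenvalues away from 0. *)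
pose L := lam d.-1; pose K := (M1 + M2) * Num.sqrt (d%:R / L).
pose C : R := 3 + d%:R.
pose Q := Num.sqrt 2 * K + 2 * C / L + 2 * (Num.sqrt 2 * K) / L.
have K0 : 0 <= K by rewrite mulr_ge0 ?sqrtr_ge0// addr_ge0// ltW.
have C0 : 0 < C by rewrite ltr_pwDl.
have Q0 : 0 < Q.
  have K2 : 0 <= Num.sqrt 2 * K by rewrite mulr_ge0// sqrtr_ge0.
  have h1 : 0 < 2 * C / L by rewrite divr_gt0// mulr_gt0.
  have h2 : 0 <= 2 * (Num.sqrt 2 * K) / L.
    by apply: divr_ge0; [exact: mulr_ge0|exact: ltW].
  by rewrite /Q; lra.
pose e2 := Num.min (Num.min 1 (L / 2)) (delta / Q).
have e2_gt0 : 0 < e2 by rewrite !lt_min ltr01 !divr_gt0.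
have e2_le1 : e2 <= 1 by rewrite !ge_min lexx.
have e2_leL : e2 <= L / 2 by rewrite !ge_min lexx orbT.
have e2_leQ : e2 * Q <= delta by rewrite -ler_pdivlMr// !ge_min lexx orbT.
have A1 := cvge0_near_le (condA1 _ e2_gt0) e50.
have A2 := cvge0_near_le (condA2' _ e2_gt0) e50.
have PL : \forall n \near \oo, (P (~` [set w | (normalized d n
     (Tstat d n (fun i => Y i%:Z w) v lam) <= x0%:E)%E]) <= (e / 5)%:E)%E.
  have mTx0 n : measurable [set w | (normalized d n
     (Tstat d n (fun i => Y i%:Z w) v lam) <= x0%:E)%E].
    exact: measurable_set_lee.
  have : \forall n \near \oo, 1 - e / 5 < (fine \o (fun n => P [set w | (normalized d n
     (Tstat d n (fun i => Y i%:Z w) v lam) <= x0%:E)%E])) n.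
    by apply: cvgr_gt x0e; exact: fine_cvg (condL x0).
  apply: filterS => n.
  rewrite probability_setC// => h.
  by rewrite -[P _]fineK ?fin_num_measure// -EFinB lee_fin; move: h => /=; lra.
near=> n.
(* The exceptional event is the union of five events of probability at most
   e / 5; the last one bounds the statistic with the true parameters. *)
have ll1 : 1 <= ln (ln (n%:R : R)) by near: n; exact: near_ge_lnln.
have bn : x0 + bnorm d (ln (n%:R : R)) <= C * ln (ln n%:R).
  by near: n; exact: near_bnorm_le.
set l := ln (ln n%:R) in ll1 bn *.
pose E1 := [set w | M1 * g n < `|partial_norm_max (fun i => Y i%:Z w) n|].
pose E2 := [set w | M2 * g n < partial_norm_max (fun i => Y (n.+1 - i)%N%:Z w) n].
pose E3 := [set w | e2 * l^-1 < `|\big[Num.max/0]_(i < d) `|lamhat n i w - lam i| |].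
pose E4 := [set w | e2 * ((Num.sqrt l)^-1 / g n) <
   `|\big[Num.max/0]_(i < d) L2norm (vhat n i w - s n i w *: v i)|].
pose E5 := ~` [set w | (normalized d n
     (Tstat d n (fun i => Y i%:Z w) v lam) <= x0%:E)%E].
have mE1 : measurable E1.
  apply: measurable_set_gt; apply: measurableT_comp => //.
  exact: (@measurable_partial_norm_max _ _ _ n (fun i => Y i%:Z)).
have mE2 : measurable E2.
  apply: measurable_set_gt.
  exact: (@measurable_partial_norm_max _ _ _ n (fun i => Y (n.+1 - i)%N%:Z)).
have mE3 : measurable E3.
  apply: measurable_set_gt; apply: measurableT_comp => //.
  apply: measurable_bigmax => i; apply: measurableT_comp => //.
  exact: measurable_funB.
have mE4 : measurable E4.
  apply: measurable_set_gt; apply: measurableT_comp => //.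
  by apply: measurable_bigmax => i; exact: measurable_L2norm_sub.
have mE5 : measurable E5.
  by apply: measurableC; exact: measurable_set_lee.
have PE1 : (P E1 <= (e / 5)%:E)%E by rewrite /E1; near: n; exact: P1.
have PE2 : (P E2 <= (e / 5)%:E)%E.
  rewrite /E2 stationary_partial_norm_max//.
  rewrite (_ : [set w | _] = [set w | M2 * g n <
      `|partial_norm_max (fun i => Y (- i%:Z) w) n|]).
    by near: n; exact: P2.
  by apply/seteqP; split => w /=; rewrite ger0_norm//; exact: bigmax_ge_id.
have PE3 : (P E3 <= (e / 5)%:E)%E by rewrite /E3 /l; near: n; exact: A1.
have PE4 : (P E4 <= (e / 5)%:E)%E by rewrite /E4 /l; near: n; exact: A2.
have PE5 : (P E5 <= (e / 5)%:E)%E by rewrite /E5; near: n; exact: PL.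
have PU (A B : set Omega) (p q : R) : measurable A -> measurable B ->
    (P A <= p%:E)%E -> (P B <= q%:E)%E -> (P (A `|` B) <= (p + q)%:E)%E.
  move=> mA mB pA qB; rewrite EFinD.
  by apply: (le_trans (measureU2 _ mA mB)); exact: leeD.
exists (E1 `|` (E2 `|` (E3 `|` (E4 `|` E5)))); split.
- by do ! apply: measurableU => //.
- have -> : e = e / 5 + (e / 5 + (e / 5 + (e / 5 + e / 5))) by field.
  do 3 (apply: (PU _ _ _ _) => //; first by do ! apply: measurableU).
  exact: (PU _ _ _ _).
move=> w /not_orP[nE1 /not_orP[nE2 /not_orP[nE3 /not_orP[nE4 /contrapT E5w]]]].
have {}nE1 : partial_norm_max (fun i => Y i%:Z w) n <= M1 * g n.
  by apply: (le_trans (ler_norm _)); rewrite leNgt; exact/negP.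
have {}nE2 : partial_norm_max (fun i => Y (n.+1 - i)%N%:Z w) n <= M2 * g n.
  by rewrite leNgt; exact/negP.
have {}nE3 (i : 'I_d) : `|lamhat n i w - lam i| <= e2 * l^-1.
  apply: (@le_trans _ _
    `|\big[Num.max/0]_(i < d) `|lamhat n i w - lam i| |); last first.
    by rewrite leNgt; exact/negP.
  by apply: le_trans (ler_norm _); exact: le_bigmax.
have {}nE4 (i : 'I_d) : L2norm (vhat n i w - s n i w *: v i) <=
    e2 * ((Num.sqrt l)^-1 / g n).
  apply: (@le_trans _ _
    `|\big[Num.max/0]_(i < d) L2norm (vhat n i w - s n i w *: v i)|); last first.
    by rewrite leNgt; exact/negP.
  apply: le_trans (ler_norm _).
  exact: (le_bigmax _ (fun i : 'I_d => L2norm (vhat n i w - s n i w *: v i))).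
have l0 : 0 < l by exact: lt_le_trans ll1.
have sl0 : 0 < Num.sqrt l by rewrite sqrtr_gt0.
have rhoL : e2 * l^-1 <= L / 2.
  apply: le_trans e2_leL; rewrite ler_piMr//; first exact: ltW.
  by rewrite invf_le1.
have lh_gt0 r : (r < d)%N -> 0 < lamhat n r w.
  move=> rd; have := nE3 (Ordinal rd); rewrite ler_norml /= => /andP[h _].
  by have := l_ge r rd; rewrite -/L; have : 0 < L by []; lra.
rewrite obsE !TstatE// /normalized /=.
set T := maxstat d n _ v lam; set Th := maxstat _ _ _ _ _.
have T_le : Num.sqrt (2 * l) * T <= C * l.
  move: E5w; rewrite /= TstatE// /normalized -EFinM -EFinB lee_fin.
  by rewrite -/T /anorm -/l; lra.
have close : `|Th - T| <= e2 * K / Num.sqrt l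
      + 2 * (e2 * l^-1) / L * (T + e2 * K / Num.sqrt l).
  apply: (@maxstat_perturb _ d n (fun i => Y i%:Z w) _ v lam _
    (fun r => s n r w) L (e2 * l^-1) (M1 * g n + M2 * g n)
    (e2 * ((Num.sqrt l)^-1 / g n))) => //.
  - by rewrite rhoL andbT divr_ge0// ltW.
  - exact: lerD.
  - by rewrite mulr_ge0 ?divr_ge0 ?invr_ge0// ltW.
  - rewrite le_eqVlt; apply/orP; left; apply/eqP; rewrite /K; field.
    by rewrite !gt_eqF.
have := scaled_close ll1 lam_gt0 K0 (ltW C0) _ T_le close e2_leQ.
rewrite e2_le1 ltW// => /(_ isT); rewrite ler_norml => /andP[h1 h2].
by rewrite -!EFinM -!EFinB -!EFinD !lee_fin /anorm -/l; split; lra.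
Unshelve. all: by end_near.
Qed.
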